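(* The family of nondeterministic mso definable string transductions (with respect to the edge representation of strings) equals the family of compositions $\rho\circ m$ (first $\rho$, then $m$) where $\rho$ is a marked string relabelling and $m$ is a deterministic (parameterless) mso definable string transduction (with respect to the edge representation).
   Context: A string $w$ of length $k$ over $\Sigma$ is represented by the graph $\mathrm{egr}(w)$: $k+1$ unlabelled nodes connected by $k$ edges forming a path whose edge labels are the consecutive symbols of $w$ (so $\mathrm{egr}(\varepsilon)$ is a single node). Graphs, MSO logic on graphs, and (deterministic) mso definable graph transductions are as usual: a transduction is given by a closed domain formula, a finite copy set $C$, node formulas $\varphi^c_\sigma(x)$ and edge formulas $\varphi^{c_1,c_2}_\gamma(x,y)$; the output graph for an input $g$ satisfying the domain formula has the copies $u^c$ for which exactly one $\varphi^c_\sigma(u)$ holds, labelled by that $\sigma$, and edges $(u^{c_1},\gamma,v^{c_2})$ whenever $g\models\varphi^{c_1,c_2}_\gamma(u,v)$. In the nondeterministic version all formulas may additionally contain free node-set variables (parameters), and each valuation of the parameters satisfying the domain formula yields an output graph. A string transduction $m\subseteq\Sigma_1^*\times\Sigma_2^*$ is a (deterministic, resp. nondeterministic) mso definable string transduction if $\{(\mathrm{egr}(w),\mathrm{egr}(z))\mid (w,z)\in m\}$ is a (deterministic, resp. nondeterministic) mso definable graph transduction. A string relabelling is given by a relation $R\subseteq\Sigma_1\times\Sigma_2$ and maps a string to all strings obtained by replacing each symbol $\sigma$ by an element of $R(\sigma)$. A marked string relabelling first maps $w$ to $\vdash w\dashv$ (adding a left end marker $\vdash$ and right end marker $\dashv$)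 and then applies a string relabelling. Composition is left-to-right: $R_1\circ R_2=\{(w_1,w_3)\mid\exists w_2:(w_1,w_2)\in R_1,(w_2,w_3)\in R_2\}$, extended to families elementwise. *)

(* Defs.v *)
From mathcomp Require Import all_boot.
Set Implicit Arguments. Unset Strict Implicit. Unset Printing Implicit Defensive.

Record graph (Sg Ga : Type) := Graph {
  gV   : finType;
  glab : gV -> Sg;
  gedg : gV -> Ga -> gV -> bool }.
Arguments Graph {Sg Ga} gV glab gedg.
Arguments gV {Sg Ga} g.
Arguments glab {Sg Ga} g _.
Arguments gedg {Sg Ga} g _ _ _.

Definition giso (Sg Ga : Type) (g h : graph Sg Ga) : Prop :=
  exists f : gV g -> gV h, bijective f /\
    (forall v, glab h (f v) = glab g v) /\
    (forall u a v, gedg h (f u) a (f v) = gedg g u a v).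

Definition egr (S : eqType) (w : seq S) : graph unit S :=
  Graph 'I_(size w).+1 (fun _ => tt)
    (fun u a v => (val v == (val u).+1) && (onth w (val u) == Some a)).

(* Node variables and node-set variables are named by natural numbers
   (two separate name spaces). *)
Inductive formula (Sg Ga : Type) :=
| FLab  : Sg -> nat -> formula Sg Ga
| FEdge : Ga -> nat -> nat -> formula Sg Ga
| FEq   : nat -> nat -> formula Sg Ga
| FIn   : nat -> nat -> formula Sg Ga
| FNot  : formula Sg Ga -> formula Sg Ga
| FAnd  : formula Sg Ga -> formula Sg Ga -> formula Sg Ga
| FOr   : formula Sg Ga -> formula Sg Ga -> formula Sg Ga
| FExN  : nat -> formula Sg Ga -> formula Sg Ga
| FExS  : nat -> formula Sg Ga -> formula Sg Ga.

Fixpoint fvN (Sg Ga : Type) (f : formula Sg Ga) : seq nat :=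
  match f with
  | FLab _ x => [:: x]
  | FEdge _ x y => [:: x; y]
  | FEq x y => [:: x; y]
  | FIn x _ => [:: x]
  | FNot f => fvN f
  | FAnd f1 f2 | FOr f1 f2 => fvN f1 ++ fvN f2
  | FExN x f => filter (fun y => y != x) (fvN f)
  | FExS _ f => fvN f
  end.

Fixpoint fvS (Sg Ga : Type) (f : formula Sg Ga) : seq nat :=
  match f with
  | FLab _ _ | FEdge _ _ _ | FEq _ _ => [::]
  | FIn _ X => [:: X]
  | FNot f => fvS f
  | FAnd f1 f2 | FOr f1 f2 => fvS f1 ++ fvS f2
  | FExN _ f => fvS f
  | FExS X f => filter (fun Y => Y != X) (fvS f)
  end.

Definition scoped (Sg Ga : Type) (nN nS : nat) (f : formula Sg Ga) : bool :=
  all (fun x => x < nN) (fvN f) && all (fun X => X < nS) (fvS f).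

Definition upd (A : Type) (e : nat -> A) (x : nat) (a : A) : nat -> A :=
  fun y => if y == x then a else e y.

(* satisfaction; unassigned node variables (None) never occur for scoped
   formulas evaluated as below *)
Fixpoint sat (Sg Ga : eqType) (g : graph Sg Ga)
    (vn : nat -> option (gV g)) (vs : nat -> {set gV g})
    (f : formula Sg Ga) {struct f} : bool :=
  match f with
  | FLab s x => if vn x is Some v then glab g v == s else false
  | FEdge a x y =>
      match vn x, vn y with Some u, Some v => gedg g u a v | _, _ => false end
  | FEq x y =>
      match vn x, vn y with Some u, Some v => u == v | _, _ => false end
  | FIn x X => if vn x is Some v then v \in vs X else false
  | FNot f => ~~ sat vn vs f
  | FAnd f1 f2 => sat vn vs f1 && sat vn vs f2
  | FOr f1 f2 => sat vn vs f1 || sat vn vs f2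
  | FExN x f => [exists v : gV g, sat (upd vn x (Some v)) vs f]
  | FExS X f => [exists A : {set gV g}, sat vn (upd vs X A) f]
  end.

Definition env0 (V : Type) : nat -> option V := fun _ => None.
Definition env1 (V : Type) (u : V) : nat -> option V := upd (@env0 V) 0 (Some u).
Definition env2 (V : Type) (u v : V) : nat -> option V :=
  upd (env1 u) 1 (Some v).

(* A specification with npar parameters (free set variables 0..npar-1),
   copy set C = 'I_ncopy, closed domain formula, node formulas
   phi^c_sigma(x) and edge formulas phi^{c1,c2}_gamma(x,y). *)
Record mso_spec (Sg1 Ga1 Sg2 Ga2 : Type) := MsoSpec {
  npar  : nat;
  ncopy : nat;
  sdom  : formula Sg1 Ga1;
  snode : 'I_ncopy -> Sg2 -> formula Sg1 Ga1;
  sedge : 'I_ncopy -> 'I_ncopy -> Ga2 -> formula Sg1 Ga1 }.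
Arguments npar {Sg1 Ga1 Sg2 Ga2} m.
Arguments ncopy {Sg1 Ga1 Sg2 Ga2} m.
Arguments sdom {Sg1 Ga1 Sg2 Ga2} m.
Arguments snode {Sg1 Ga1 Sg2 Ga2} m _ _.
Arguments sedge {Sg1 Ga1 Sg2 Ga2} m _ _ _.

Definition wf_spec (Sg1 Ga1 Sg2 Ga2 : finType)
    (S : mso_spec Sg1 Ga1 Sg2 Ga2) : Prop :=
  scoped 0 (npar S) (sdom S) /\
  (forall c s, scoped 1 (npar S) (snode S c s)) /\
  (forall c d a, scoped 2 (npar S) (sedge S c d a)).

Definition det_spec (Sg1 Ga1 Sg2 Ga2 : finType)
    (S : mso_spec Sg1 Ga1 Sg2 Ga2) : Prop := wf_spec S /\ npar S = 0.

Section Output.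
Variables (Sg1 Ga1 Sg2 Ga2 : finType) (S : mso_spec Sg1 Ga1 Sg2 Ga2)
  (g : graph Sg1 Ga1) (P : nat -> {set gV g}).

Definition out_nodeb (t : gV g * 'I_(ncopy S) * Sg2) : bool :=
  sat (env1 t.1.1) P (snode S t.1.2 t.2) &&
  (#|[pred s | sat (env1 t.1.1) P (snode S t.1.2 s)]| == 1).

Definition out_V : finType := {t : gV g * 'I_(ncopy S) * Sg2 | out_nodeb t}.

Definition out_graph : graph Sg2 Ga2 :=
  Graph out_V (fun t => (val t).2)
    (fun t a t' => sat (env2 (val t).1.1 (val t').1.1) P
                       (sedge S (val t).1.2 (val t').1.2 a)).
End Output.

Definition spec_rel (Sg1 Ga1 Sg2 Ga2 : finType) (S : mso_spec Sg1 Ga1 Sg2 Ga2)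
    (g : graph Sg1 Ga1) (h : graph Sg2 Ga2) : Prop :=
  exists P : nat -> {set gV g},
    sat (@env0 _) P (sdom S) /\ giso (out_graph S P) h.

Definition string_rel_graphs (S1 S2 : finType) (m : seq S1 -> seq S2 -> Prop)
    (g : graph unit S1) (h : graph unit S2) : Prop :=
  exists w z, m w z /\ giso g (egr w) /\ giso h (egr z).

Definition nmso_string (S1 S2 : finType) (m : seq S1 -> seq S2 -> Prop) : Prop :=
  exists S : mso_spec unit S1 unit S2, wf_spec S /\
    forall g h, spec_rel S g h <-> string_rel_graphs m g h.

Definition dmso_string (S1 S2 : finType) (m : seq S1 -> seq S2 -> Prop) : Prop :=
  exists S : mso_spec unit S1 unit S2, det_spec S /\
    forall g h, spec_rel S g h <-> string_rel_graphs m g h.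

Definition relab (A B : Type) (R : A -> B -> bool) (w : seq A) (u : seq B) : Prop :=
  all2 R w u.

Definition marked (A : finType) : finType := (A + bool)%type.
Definition lmark (A : finType) : marked A := inr true.
Definition rmark (A : finType) : marked A := inr false.
Definition mark (A : finType) (w : seq A) : seq (marked A) :=
  lmark A :: map inl w ++ [:: rmark A].

Definition marked_relab (A B : finType) (R : marked A -> B -> bool)
    (w : seq A) (u : seq B) : Prop := relab R (mark w) u.

Definition rcomp (A B C : Type) (r1 : A -> B -> Prop) (r2 : B -> C -> Prop)
    : A -> C -> Prop := fun a c => exists b, r1 a b /\ r2 b c.

(* Main.v *)
(* A parameter valuation on egr(w) is a labelling of its |w|+1 nodes, and a
   node of egr(w) can be identified with the edge entering its counterpart in
   egr(|- w -|).  So a nondeterministic relabelling of the marked string guesses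
   the parameters, and conversely parameters can guess a relabelling.
   In each direction the remaining work is the backward translation of MSO
   formulas along an interpretation of one graph in another: for the forward
   direction the interior nodes of the encoding carry egr(w), for the converse
   two extra copies provide the first and last node of egr(|- w -|).
   No formula has to check that labels or guesses are meaningful: the given
   transduction relates only string graphs, so its domain formula rejects every
   interpreted graph that is not one. *)
Require Import Defs.
From mathcomp Require Import all_boot.
Set Implicit Arguments. Unset Strict Implicit. Unset Printing Implicit Defensive.

(** * Scoping and satisfaction *)

Section Syntax.
Variables Sg Ga : Type.
Implicit Types (f : formula Sg Ga) (P Q : pred nat).

(** Below a binder the bound name joins the allowed ones, and the result need not be an initial
    segment of the numbers; with predicates instead of bounds, inductions on formulas go through. *)
Fixpoint sc P Q f : bool :=
  match f with
  | FLab _ x => P x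
  | FEdge _ x y => P x && P y
  | FEq x y => P x && P y
  | FIn x X => P x && Q X
  | FNot f => sc P Q f
  | FAnd f1 f2 | FOr f1 f2 => sc P Q f1 && sc P Q f2
  | FExN x f => sc (fun y => (y != x) ==> P y) Q f
  | FExS X f => sc P (fun Y => (Y != X) ==> Q Y) f
  end.

Lemma scE P Q f : sc P Q f = all P (fvN f) && all Q (fvS f).
Proof.
elim: f P Q => [s x|a x y|x y|x X|f IH|f1 IH1 f2 IH2|f1 IH1 f2 IH2|x f IH|X f IH] P Q //=;
  rewrite ?andbT ?IH ?IH1 ?IH2 ?all_cat ?all_filter //; by rewrite andbACA.
Qed.

Lemma scopedE n k f : scoped n k f = sc (fun x => x < n) (fun X => X < k) f.
Proof. by rewrite scE. Qed.

Lemma sub_sc P Q P' Q' f :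
  subpred P P' -> subpred Q Q' -> sc P Q f -> sc P' Q' f.
Proof.
by move=> sP sQ; rewrite !scE => /andP[/(sub_all sP)-> /(sub_all sQ)->].
Qed.

Lemma eq_sc P Q P' Q' f : P =1 P' -> Q =1 Q' -> sc P Q f = sc P' Q' f.
Proof. by move=> eP eQ; rewrite !scE (eq_all eP) (eq_all eQ). Qed.

(** The quantifier makes the formula closed and assigns the variable: on an unassigned variable
    [FEq] is false, so its negation would hold. *)
Definition FFalse : formula Sg Ga := FExN 0 (FNot (FEq _ _ 0 0)).
Definition FAllN x f := FNot (FExN x (FNot f)).
Definition FAllS X f := FNot (FExS X (FNot f)).
Definition FImp f1 f2 := FOr (FNot f1) f2.
Definition FBig (I : finType) (F : I -> formula Sg Ga) :=
  foldr (fun i f => FOr (F i) f) FFalse (enum I).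

Lemma sc_FBig (I : finType) P Q (F : I -> formula Sg Ga) :
  sc P Q (FBig F) = [forall i, sc P Q (F i)].
Proof.
rewrite /FBig; transitivity (all (fun i => sc P Q (F i)) (enum I)).
  by elim: (enum I) => [|i s /= ->] //=.
by apply/allP/forallP => [H i|H i _]; rewrite ?H ?mem_enum.
Qed.

Lemma sc_foldr_FExS P Q l f :
  sc P Q (foldr (@FExS _ _) f l) = sc P (fun X => (X \notin l) ==> Q X) f.
Proof.
elim: l Q => [|X l IH] Q //=; rewrite IH; apply: eq_sc => // Y.
by rewrite inE negb_or; case: (Y == X); case: (Y \in l).
Qed.
End Syntax.

Section Sat.
Variables (Sg Ga : eqType) (g : graph Sg Ga).
Implicit Types (f : formula Sg Ga) (vn : nat -> option (gV g))
  (vs : nat -> {set gV g}).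

Lemma sat_ext (P Q : pred nat) f vn vn' vs vs' : sc P Q f ->
    (forall x, P x -> vn x = vn' x) -> (forall X, Q X -> vs X = vs' X) ->
  sat vn vs f = sat vn' vs' f.
Proof.
elim: f P Q vn vn' vs vs' =>
  [s x|a x y|x y|x X|f IH|f1 IH1 f2 IH2|f1 IH1 f2 IH2|x f IH|X f IH]
  P Q vn vn' vs vs' /=.
- by move=> Px eN _; rewrite eN.
- by case/andP=> Px Py eN _; rewrite !eN.
- by case/andP=> Px Py eN _; rewrite !eN.
- by case/andP=> Px QX eN eS; rewrite eN // eS.
- by move=> sf eN eS; rewrite (IH _ _ _ _ _ _ sf eN eS).
- by case/andP=> s1 s2 eN eS;
  rewrite (IH1 _ _ _ _ _ _ s1 eN eS) (IH2 _ _ _ _ _ _ s2 eN eS).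
- by case/andP=> s1 s2 eN eS;
  rewrite (IH1 _ _ _ _ _ _ s1 eN eS) (IH2 _ _ _ _ _ _ s2 eN eS).
- move=> sf eN eS; apply: eq_existsb => v; apply: (IH _ _ _ _ _ _ sf) => // y.
  by rewrite /upd; case: eqP => //= _; apply: eN.
- move=> sf eN eS; apply: eq_existsb => A; apply: (IH _ _ _ _ _ _ sf) => // Y.
  by rewrite /upd; case: eqP => //= _; apply: eS.
Qed.

Lemma sat_eq f vn vn' vs vs' : vn =1 vn' -> vs =1 vs' ->
  sat vn vs f = sat vn' vs' f.
Proof.
by move=> eN eS; apply: (@sat_ext predT predT) => //; rewrite scE !all_predT.
Qed.

Lemma sat_FFalse vn vs : sat vn vs (FFalse Sg Ga) = false.
Proof. by apply/existsP=> -[v]; rewrite /= /upd /= eqxx. Qed.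

Lemma sat_FExN vn vs x f :
  sat vn vs (FExN x f) = [exists v, sat (upd vn x (Some v)) vs f].
Proof. by []. Qed.

Lemma sat_FAllN vn vs x f :
  sat vn vs (FAllN x f) = [forall v, sat (upd vn x (Some v)) vs f].
Proof. by rewrite /= negb_exists; apply: eq_forallb => v /=; rewrite negbK. Qed.

Lemma sat_FAllS vn vs X f :
  sat vn vs (FAllS X f) = [forall A, sat vn (upd vs X A) f].
Proof. by rewrite /= negb_exists; apply: eq_forallb => v /=; rewrite negbK. Qed.

Lemma sat_FAnd vn vs f1 f2 :
  sat vn vs (FAnd f1 f2) = sat vn vs f1 && sat vn vs f2.
Proof. by []. Qed.

Lemma sat_FImp vn vs f1 f2 :
  sat vn vs (FImp f1 f2) = (sat vn vs f1 ==> sat vn vs f2).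
Proof. by rewrite /= implybE. Qed.

Lemma sat_FBig (I : finType) vn vs (F : I -> formula Sg Ga) :
  sat vn vs (FBig F) = [exists i, sat vn vs (F i)].
Proof.
rewrite /FBig; transitivity (has (fun i => sat vn vs (F i)) (enum I)).
  by elim: (enum I) => [|i s /= ->] //; apply: sat_FFalse.
by apply/hasP/existsP => [[i _ H]|[i H]]; exists i; rewrite ?mem_enum.
Qed.

(** A block of set quantifiers chooses all its variables at once; the translation below turns each
    set quantifier into such a block. *)
Lemma sat_foldr_FExS vn vs l f : sat vn vs (foldr (@FExS _ _) f l) <->
  exists vs', (forall X, X \notin l -> vs' X = vs X) /\ sat vn vs' f.
Proof.
elim: l vs => [|X l IH] vs /=.
  split=> [H|[vs' [E]]]; first by exists vs.
  by rewrite (@sat_eq f vn vn vs' vs) // => X; apply: E.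
split=> [/existsP[A /IH[vs' [E H]]]|[vs' [E H]]].
  exists vs'; split=> // Y; rewrite inE negb_or => /andP[YX Yl].
  by rewrite E // /upd (negbTE YX).
apply/existsP; exists (vs' X); apply/IH; exists vs'; split=> // Y Yl.
by rewrite /upd; case: eqP => [->//|/eqP YX]; rewrite E // inE negb_or YX.
Qed.
End Sat.

(** * Isomorphism invariance of satisfaction and of outputs *)

Section Iso.
Variables (Sg Ga : eqType).
Implicit Types g h : graph Sg Ga.

Definition iso_by g h (f : gV g -> gV h) :=
  [/\ bijective f, forall v, glab h (f v) = glab g v
    & forall u a v, gedg h (f u) a (f v) = gedg g u a v].

Lemma iso_by_giso g h (f : gV g -> gV h) : iso_by f -> giso g h.
Proof. by case=> *; exists f. Qed.

Lemma giso_iso_by g h : giso g h -> exists f : gV g -> gV h, iso_by f.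
Proof. by case=> f [? [? ?]]; exists f. Qed.

Lemma giso_refl g : giso g g.
Proof. by exists id; do !split=> //; exists id. Qed.

Lemma giso_sym g h : giso g h -> giso h g.
Proof.
case=> f [[f' fK f'K] [fl fe]]; exists f'; split; first by exists f.
by split=> *; rewrite -?fl -?fe !f'K.
Qed.

Lemma giso_trans g h k : giso g h -> giso h k -> giso g k.
Proof.
case=> f [fb [fl fe]] [f' [fb' [fl' fe']]]; exists (f' \o f).
by split; [apply: bij_comp|split=> *; rewrite /= ?fl' ?fe'].
Qed.

Lemma sat_iso g h (f : gV g -> gV h) (F : formula Sg Ga) vn
    (vs : nat -> {set gV g}) vn' (vs' : nat -> {set gV h}) :
    iso_by f -> (forall x, vn' x = omap f (vn x)) ->
    (forall X v, (f v \in vs' X) = (v \in vs X)) ->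
  sat vn' vs' F = sat vn vs F.
Proof.
case=> fb fl fe; have fi := bij_inj fb; case: (fb) => f' fK f'K.
elim: F vn vs vn' vs' =>
  [s x|a x y|x y|x X|F IH|F1 IH1 F2 IH2|F1 IH1 F2 IH2|x F IH|X F IH]
  vn vs vn' vs' eN eS /=; rewrite ?eN.
- by case: (vn x) => //= v; rewrite fl.
- by case: (vn x) => //= u; case: (vn y) => //= v; rewrite fe.
- by case: (vn x) => //= u; case: (vn y) => //= v; rewrite (inj_eq fi).
- by case: (vn x) => //= u; rewrite eS.
- by rewrite (IH vn vs).
- by rewrite (IH1 vn vs) // (IH2 vn vs).
- by rewrite (IH1 vn vs) // (IH2 vn vs).
- apply/existsP/existsP => -[v H]; [exists (f' v)|exists (f v)].
    rewrite -(IH _ _ (upd vn' x (Some v)) vs') // => y.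
    by rewrite /upd; case: eqP => //= _; rewrite f'K.
  rewrite (IH (upd vn x (Some v)) vs) // => y.
  by rewrite /upd; case: eqP.
- apply/existsP/existsP => -[A H]; [exists (f @^-1: A)|exists (f @: A)].
    rewrite -(IH _ _ vn' (upd vs' X A)) // => Y v.
    by rewrite /upd; case: eqP => //= _; rewrite inE.
  rewrite (IH vn (upd vs X A)) // => Y v.
  by rewrite /upd; case: eqP => //= _; rewrite mem_imset.
Qed.
End Iso.

Section Outputs.
Variables Sg1 Ga1 Sg2 Ga2 : finType.
Implicit Types S T : mso_spec Sg1 Ga1 Sg2 Ga2.

Definition spec_at S (g : graph Sg1 Ga1) (P : nat -> {set gV g})
    (h : graph Sg2 Ga2) : Prop :=
  sat (@env0 _) P (sdom S) /\ giso (out_graph S P) h.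
End Outputs.

(** It suffices that [F] reaches the copies satisfying some node formula of [S], since the other
    copies give no output node. *)
Lemma out_giso (Sg1 Ga1 Sg1' Ga1' Sg2 Ga2 : finType)
    (T : mso_spec Sg1' Ga1' Sg2 Ga2) (S : mso_spec Sg1 Ga1 Sg2 Ga2)
    (g' : graph Sg1' Ga1') (g : graph Sg1 Ga1)
    (P' : nat -> {set gV g'}) (P : nat -> {set gV g})
    (F : gV g' * 'I_(ncopy T) -> gV g * 'I_(ncopy S)) :
    injective F ->
    (forall t s, sat (env1 (F t).1) P (snode S (F t).2 s) =
                 sat (env1 t.1) P' (snode T t.2 s)) ->
    (forall y s, sat (env1 y.1) P (snode S y.2 s) -> exists t, y = F t) ->
    (forall t t' a, sat (env2 (F t).1 (F t').1) P (sedge S (F t).2 (F t').2 a) =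
                    sat (env2 t.1 t'.1) P' (sedge T t.2 t'.2 a)) ->
  giso (out_graph T P') (out_graph S P).
Proof.
move=> Fi Fn Fs Fe.
have ob (t : gV g' * 'I_(ncopy T) * Sg2) :
  out_nodeb P (F t.1, t.2) = out_nodeb P' t.
  rewrite /out_nodeb /= Fn; congr (_ && (_ == _)).
  by apply: eq_card => s; rewrite !inE Fn.
have obV (t : gV (out_graph T P')) : out_nodeb P (F (val t).1, (val t).2).
  by rewrite ob (valP t).
exists (fun t => Sub (F (val t).1, (val t).2) (obV t)); split; last first.
  by split=> //= t a t'; rewrite Fe.
(* Surjectivity by counting: the image under [G] of the output nodes of [T] contains all output
   nodes of [S]. *)
apply: inj_card_bij => [t t' /(congr1 val) /= [/Fi e1 e2]|].
  by apply: val_inj; rewrite [LHS]surjective_pairing e1 e2 -surjective_pairing.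
rewrite !card_sig.
pose G (t : gV g' * 'I_(ncopy T) * Sg2) := (F t.1, t.2).
have Gi : injective G by move=> [x s] [x' s'] [] /Fi -> ->.
rewrite -(card_imset _ Gi); apply: subset_leq_card; apply/subsetP => -[y s] H.
have {}H : out_nodeb P (y, s) by [].
have [t yE] : exists t, y = F t by case/andP: H => /Fs.
apply/imsetP; exists (t, s); last by rewrite /G yE.
by have := ob (t, s); rewrite /= -yE H => /esym.
Qed.

Section Invariance.
Variables Sg1 Ga1 Sg2 Ga2 : finType.
Implicit Types S T : mso_spec Sg1 Ga1 Sg2 Ga2.

Lemma spec_at_iso S (g g1 : graph Sg1 Ga1) (f : gV g -> gV g1)
    (P : nat -> {set gV g}) (P1 : nat -> {set gV g1}) (h : graph Sg2 Ga2) :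
    iso_by f -> (forall X v, (f v \in P1 X) = (v \in P X)) ->
  spec_at S P h -> spec_at S P1 h.
Proof.
move=> fI fP [D /giso_sym H]; have [fb _ _] := fI.
split; first by rewrite (sat_iso (vn := @env0 _) _ fI _ fP) ?D.
have fi := bij_inj fb; apply/giso_sym/(giso_trans H).
apply: (out_giso (F := fun t => (f t.1, t.2))) => /=.
- by move=> [u c] [v d] [] /fi -> ->.
- by move=> t s; apply: (sat_iso _ fI _ fP) => -[|x].
- by move=> [y c] s _; case: fb => f' fK f'K; exists (f' y, c); rewrite /= f'K.
- by move=> t t' a; apply: (sat_iso _ fI _ fP) => -[|[|x]].
Qed.

Lemma spec_rel_iso S (g g1 : graph Sg1 Ga1) (h h1 : graph Sg2 Ga2) :
  giso g g1 -> giso h h1 -> spec_rel S g h -> spec_rel S g1 h1.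
Proof.
move=> /giso_iso_by[f fI] hI [P [D oI]].
have [_ oI1] : spec_at S P h1 by split=> //; apply: giso_trans hI.
have fi : injective f by case: fI => /bij_inj.
exists (fun X => f @: P X); apply: (spec_at_iso fI (P := P)) => // X v.
by rewrite mem_imset.
Qed.

Lemma spec_at_ext S (g : graph Sg1 Ga1) (P P1 : nat -> {set gV g}) h :
  wf_spec S -> (forall X, X < npar S -> P X = P1 X) ->
  spec_at S P h -> spec_at S P1 h.
Proof.
rewrite /wf_spec; case=> wd [wn we] E [D oI].
have satE n (f : formula Sg1 Ga1) vn : scoped n (npar S) f ->
  sat vn P1 f = sat vn P f.
  by rewrite scopedE => sf; apply/esym/(sat_ext sf) => // x _; apply: E.
split; first by rewrite (satE 0).
apply: giso_trans oI; apply: giso_sym.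
apply: (out_giso (F := id)) => //.
- by move=> t s; apply: (satE 1).
- by move=> y s _; exists y.
- by move=> t t' a; apply: (satE 2).
Qed.
End Invariance.

(** * Definability of string graphs *)

Definition succ (A : finType) (g : graph unit A) (u v : gV g) :=
  [exists a, gedg g u a v].

(** The first four clauses are local and still admit a path together with disjoint cycles; the
    induction clause over [X] excludes these. *)
Definition is_path (A : finType) (g : graph unit A) (f l : gV g) :=
  [/\ forall x : gV g, [exists y, succ y x] = (x != f),
      forall x : gV g, [exists y, succ x y] = (x != l),
      forall x a y b z, gedg g x a y -> gedg g x b z -> a = b /\ y = z,
      forall x y z : gV g, succ x z -> succ y z -> x = y
    & forall X : {set gV g}, f \in X ->
        (forall x y, x \in X -> succ x y -> y \in X) -> forall x, x \in X].

Section MultiPath.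
Variable A : finType.

(* A path whose edges carry sets of labels: a guessed relabelling need not
   assign exactly one label to each edge. *)
Definition lpath N (L : nat -> A -> bool) : graph unit A :=
  Graph 'I_N.+1 (fun _ => tt) (fun u a v => (val v == (val u).+1) && L (val u) a).

(** The inverse isomorphism sends successive nodes to successive nodes, so it is a shift, and the
    last node leaves no room for a positive shift. Hence the isomorphism is the identity and each
    edge carries exactly one label. *)
Lemma giso_lpath N L (w : seq A) : giso (lpath N L) (egr w) ->
  N = size w /\ forall i a, i < N -> L i a = (onth w i == Some a).
Proof.
case=> f [fb [_ fe]]; have NE : N = size w.
  by have /= := bij_eq_card fb; rewrite !card_ord => -[].
subst N; split=> // i a iw; case: fb => g fK gK.
have gS k (kw : k < size w) :
    val (g (Ordinal (kw : k.+1 < (size w).+1))) =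
    (val (g (Ordinal (leqW kw : k < (size w).+1)))).+1.
  case E: (onth w k) => [b|]; last first.
    by have := kw; rewrite -onthTE E.
  apply/eqP; have := fe (g (Ordinal (leqW kw))) b (g (Ordinal (kw : k.+1 < (size w).+1))).
  by rewrite !gK /= eqxx E eqxx /= => /esym/andP[].
have gD k (kw : k < (size w).+1) : val (g (Ordinal kw)) = g ord0 + k.
  elim: k kw => [|k IH] kw; first by rewrite addn0; congr (val (g _)); apply: val_inj.
  by rewrite (gS k kw) IH addnS.
have g0 : val (g ord0) = 0.
  have : val (g ord0) + size w <= size w.
    by rewrite -(gD _ (ltnSn _)) -ltnS; apply: ltn_ord.
  by case: (val (g ord0)) => // k; rewrite addSn ltnNge leq_addl.
have gI (k : 'I_(size w).+1) : g k = k.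
  by apply: val_inj; case: k => k kw; rewrite gD [nat_of_ord _]g0.
have fI (k : 'I_(size w).+1) : f k = k by rewrite -{1}(gI k) gK.
have := fe (Ordinal (leqW iw : i < (size w).+1)) a (Ordinal (iw : i.+1 < (size w).+1)).
by rewrite !fI /= eqxx.
Qed.

Lemma lpath_egr (w : seq A) L :
    (forall i a, i < size w -> L i a = (onth w i == Some a)) ->
  giso (lpath (size w) L) (egr w).
Proof.
move=> LE; exists id; split; first by exists id.
split=> //= u a v; case: eqP => //= vE; rewrite LE //.
by rewrite -ltnS -vE.
Qed.

Lemma egr_inj (w w' : seq A) : giso (egr w) (egr w') -> w = w'.
Proof.
(* By computation, [egr w] is an [lpath] whose label sets are singletons. *)
move=> /(@giso_lpath _ (fun i a => onth w i == Some a))[sw E].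
apply: eq_from_onth => i; case: (ltnP i (size w)) => iw; last first.
  by rewrite !onth_default -?sw.
case F: (onth w i) => [a|]; last by move: iw; rewrite -onthTE F.
by have := E i a iw; rewrite F eqxx => /esym/eqP.
Qed.

Lemma choose_string N (L : nat -> A -> Prop) :
  (forall i, i < N -> exists a, L i a) ->
  exists w, size w = N /\ forall i, i < N -> exists2 a, onth w i = Some a & L i a.
Proof.
elim: N => [|N IH] H; first by exists [::].
have [i iN|w [sw wP]] := IH; first by apply: H; apply: leqW.
have [a La] := H N (ltnSn N); exists (rcons w a); rewrite size_rcons sw; split=> // i.
rewrite ltnS leq_eqVlt => /predU1P[->|iN].
  by exists a; rewrite // onthE map_rcons nth_rcons size_map sw ltnn eqxx.
have [b wb Lb] := wP i iN; exists b => //.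
by rewrite onthE map_rcons nth_rcons size_map sw iN -onthE.
Qed.

Lemma succ_egr (w : seq A) (u v : gV (egr w)) :
  succ u v = (val v == (val u).+1).
Proof.
apply/existsP/eqP => [[a /andP[/eqP]]|vE] //.
case E: (onth w (val u)) => [a|]; first by exists a; rewrite /= vE E !eqxx.
by have := ltn_ord v; rewrite [nat_of_ord v]vE ltnS -onthTE E.
Qed.

Lemma is_path_egr (w : seq A) : is_path (g := egr w) ord0 ord_max.
Proof.
split.
- move=> x; apply/existsP/idP => [[y]|x0]; rewrite ?succ_egr.
    by move=> /eqP xE; apply/eqP => x0; rewrite x0 in xE.
  have xp : 0 < val x by rewrite lt0n.
  have yl : (val x).-1 < (size w).+1 by apply: leq_ltn_trans (leq_pred _) (ltn_ord x).
  by exists (Ordinal yl); rewrite succ_egr /= prednK.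
- move=> x; apply/existsP/idP => [[y]|x0]; rewrite ?succ_egr.
    move=> /eqP yE; apply/eqP => xE; have := ltn_ord y.
    by rewrite [nat_of_ord y]yE xE /= ltnn.
  have xl : (val x).+1 < (size w).+1.
    by rewrite ltnS ltn_neqAle -ltnS ltn_ord andbT.
  by exists (Ordinal xl); rewrite succ_egr.
- move=> x a y b z /andP[/eqP yE /eqP aE] /andP[/eqP zE]; rewrite aE => /eqP[].
  by split=> //; apply: val_inj; rewrite yE zE.
- by move=> x y z; rewrite !succ_egr => /eqP -> /eqP[] /val_inj.
- move=> X X0 XS [x xw]; elim: x xw => [|x IH] xw.
    by rewrite (_ : Ordinal xw = ord0) //; apply: val_inj.
  by apply: (XS (Ordinal (ltnW xw))); rewrite ?succ_egr.
Qed.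

(** Sending [l] back to [f] closes the path to a cycle: [F] is a total injection whose orbit of [f]
    is the whole graph, and its iterates number the nodes. *)
Lemma is_path_giso (g : graph unit A) (f l : gV g) :
  is_path f l -> exists w, giso g (egr w).
Proof.
case=> hf hl hd hi hc.
pose F x := if x == l then f else odflt f [pick y | succ x y].
have FE x y : succ x y -> F x = y.
  move=> /[dup] xy /existsP[a ea]; rewrite /F.
  have -> : x == l = false by apply/negbTE; rewrite -hl; apply/existsP; exists y.
  case: pickP => [z /existsP[b eb]|/(_ y)]; last by rewrite xy.
  by have [] := hd _ _ _ _ _ ea eb.
have FS x : x != l -> succ x (F x).
  by rewrite -hl => /existsP[y xy]; rewrite (FE _ _ xy).
have Ff x : succ x f = false.
  by apply/negbTE/negP=> xf; have := hf f; rewrite eqxx => /existsP[]; exists x.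
have Fi : injective F.
  move=> x y; have [->|xl] := eqVneq x l; have [->|yl] := eqVneq y l => //.
  - by move=> E; have := FS y yl; rewrite -E /F eqxx Ff.
  - by move=> E; have := FS x xl; rewrite E /F eqxx Ff.
  - by move=> E; apply: (hi _ _ (F x)); rewrite ?FS // E FS.
have fc x : fconnect F f x.
  suff : x \in [set y | fconnect F f y] by rewrite inE.
  apply: hc => [|y z]; rewrite !inE ?connect0 // => fy /FE <-.
  exact: connect_trans fy (fconnect1 _ _).
have [N NE] : exists N, order F f = N.+1.
  by exists (order F f).-1; rewrite prednK // order_gt0.
pose p (i : 'I_N.+1) := iter i F f.
have pI (i j : nat) : i < N.+1 -> j < N.+1 -> iter i F f = iter j F f -> i = j.
  rewrite -NE => iN jN E; rewrite -(findex_iter iN) -(findex_iter jN).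
  by rewrite E.
have pN : F (iter N F f) = f by rewrite -iterS -NE iter_order.
(* Reaching [l] earlier would bring [f] back among the first [N.+1] iterates, which are distinct. *)
have pnl i : i < N -> iter i F f != l.
  move=> iN; apply/eqP=> E; have : iter i.+1 F f = iter 0 F f.
    by rewrite iterS E /F eqxx.
  by move/pI; rewrite ltnS iN => /(_ isT isT).
have [i iN|w [sw wP]] := @choose_string N (fun i a => gedg g (iter i F f) a (iter i.+1 F f)).
  by have /existsP[a ea] := FS _ (pnl i iN); exists a.
subst N; exists w; apply: giso_sym; exists p; split.
  apply: inj_card_bij => [i j /pI E|].
    by apply: val_inj; apply: E.
  by rewrite card_ord -NE; apply/subset_leq_card/subsetP => x _; apply: fc.
split=> [v|i a j]; first by case: (glab _ _).
apply/idP/andP => [e|[/eqP jE /eqP aE]].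
  have se : succ (p i) (p j) by apply/existsP; exists a.
  have pj : p j = F (p i) by rewrite (FE _ _ se).
  have iw : i < size w.
    (* The last iterate is sent back to [f], which no edge enters. *)
    rewrite ltn_neqAle -ltnS ltn_ord andbT; apply/eqP => iE.
    by move: se; rewrite pj {2}/p iE pN Ff.
  have jE : val j = i.+1 := pI j i.+1 (ltn_ord j) iw pj.
  split; first by apply/eqP.
  have [b -> eb] := wP i iw; apply/eqP; congr Some.
  rewrite /p jE in e; by have [] := hd _ _ _ _ _ eb e.
have iw : i < size w by rewrite -onthTE [onth _ _]aE.
by have [b] := wP i iw; rewrite [onth _ _]aE => -[<-]; rewrite /p [nat_of_ord j]jE.
Qed.
End MultiPath.

Section StringFormula.
Variable A : finType.
Local Notation form := (formula unit A).
Local Notation Eq := (FEq unit A).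

Definition FSucc x y : form := FBig (fun a : A => FEdge unit a x y).

Lemma sc_FSucc (P Q : pred nat) x y : P x -> P y -> sc P Q (FSucc x y).
Proof. by move=> Px Py; rewrite sc_FBig; apply/forallP => a /=; rewrite Px. Qed.

(** Node variables 0 and 1 name the two ends, and the conjuncts follow the clauses of [is_path]. In
    the third, different labels on two out-edges already are a violation, so the remaining test is
    then the true formula [Eq 2 2]. *)
Definition FPath : form :=
  FAnd (FAllN 2 (FAnd (FImp (FExN 3 (FSucc 3 2)) (FNot (Eq 2 0)))
                      (FImp (FNot (Eq 2 0)) (FExN 3 (FSucc 3 2)))))
 (FAnd (FAllN 2 (FAnd (FImp (FExN 3 (FSucc 2 3)) (FNot (Eq 2 1)))
                      (FImp (FNot (Eq 2 1)) (FExN 3 (FSucc 2 3)))))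
 (FAnd (FNot (FExN 2 (FExN 3 (FExN 4 (FBig (fun ab : A * A =>
          FAnd (FAnd (FEdge unit ab.1 2 3) (FEdge unit ab.2 2 4))
               (if ab.1 == ab.2 then FNot (Eq 3 4) else Eq 2 2)))))))
 (FAnd (FAllN 2 (FAllN 3 (FAllN 4
          (FImp (FAnd (FSucc 2 4) (FSucc 3 4)) (Eq 2 3)))))
       (FAllS 0 (FImp (FAnd (FIn unit A 0 0) (FAllN 2 (FAllN 3
            (FImp (FAnd (FIn unit A 2 0) (FSucc 2 3)) (FIn unit A 3 0)))))
          (FAllN 2 (FIn unit A 2 0))))))).

Definition FString : form := FExN 0 (FExN 1 FPath).

Lemma sc_FString P Q : sc P Q FString.
Proof.
rewrite /= !sc_FSucc // sc_FBig /= !andbT; apply/forallP => -[a b] /=.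
by case: ifP.
Qed.

Variable g : graph unit A.
Implicit Types (vn : nat -> option (gV g)) (vs : nat -> {set gV g}).

Lemma sat_FSucc vn vs x y u v : vn x = Some u -> vn y = Some v ->
  sat vn vs (FSucc x y) = succ u v.
Proof.
by move=> xu yv; rewrite sat_FBig; apply: eq_existsb => a /=; rewrite xu yv.
Qed.

Lemma sat_FPath vn vs f l : vn 0 = Some f -> vn 1 = Some l ->
  sat vn vs FPath <-> is_path f l.
Proof.
move=> vf vl.
have sE vn' u v x y : vn' x = Some u -> vn' y = Some v ->
  sat vn' vs (FSucc x y) = succ u v by apply: sat_FSucc.
rewrite /FPath !sat_FAnd !sat_FAllN sat_FAllS; split=> [/and5P[]|[h1 h2 h3 h4 h5]].
  move=> /forallP h1 /forallP h2 h3 /forallP h4 /forallP h5; split.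
  - move=> x; move: (h1 x); rewrite /= /upd /= vf.
    rewrite (@eq_existsb _ _ (fun y => succ y x)) => [|y]; last exact: sE.
    by case: [exists y, _] (x == f) => [] [].
  - move=> x; move: (h2 x); rewrite /= /upd /= vl.
    rewrite (@eq_existsb _ _ (fun y => succ x y)) => [|y]; last exact: sE.
    by case: [exists y, _] (x == l) => [] [].
  - move=> x a y b z xy xz.
    suff /andP[/eqP-> /eqP->] : (a == b) && (y == z) by [].
    move: h3 => /=; apply: contraR => ab.
    apply/existsP; exists x; apply/existsP; exists y; apply/existsP; exists z.
    rewrite /= sat_FBig; apply/existsP; exists (a, b); rewrite /= /upd /= xy xz /=.
    by move: ab; case: (a == b) => //=; rewrite eqxx.
  - move=> x y z xz yz; apply/eqP.
    move: (h4 x); rewrite sat_FAllN => /forallP/(_ y).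
    rewrite sat_FAllN => /forallP/(_ z).
    rewrite sat_FImp sat_FAnd (sE _ x z) // (sE _ y z) //.
    by rewrite xz yz.
  - move=> X fX XS x; move: (h5 X); rewrite sat_FImp sat_FAnd !sat_FAllN.
    have -> : sat vn (upd vs 0 X) (FIn unit A 0 0) by rewrite /= vf.
    move=> /implyP H; apply: (forallP (H _) x).
    apply/forallP => y; rewrite sat_FAllN; apply/forallP => z.
    rewrite sat_FImp sat_FAnd; apply/implyP => /andP[yX].
    rewrite (@sat_FSucc _ _ _ _ y z) //; apply: XS; exact: yX.
apply/and5P; split.
- apply/forallP => x; rewrite sat_FAnd !sat_FImp /= /upd /= vf.
  rewrite (@eq_existsb _ _ (fun y => succ y x)) => [|y]; last exact: sE.
  by rewrite h1 implybb.
- apply/forallP => x; rewrite sat_FAnd !sat_FImp /= /upd /= vl.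
  rewrite (@eq_existsb _ _ (fun y => succ x y)) => [|y]; last exact: sE.
  by rewrite h2 implybb.
- rewrite /=; apply/existsP => -[x /existsP[y /existsP[z]]].
  rewrite sat_FBig => /existsP[[a b]]; rewrite /= /upd /= => /andP[/andP[xy xz]].
  by have [-> ->] := h3 _ _ _ _ _ xy xz; rewrite eqxx /= eqxx.
- apply/forallP => x; rewrite sat_FAllN; apply/forallP => y.
  rewrite sat_FAllN; apply/forallP => z.
  rewrite sat_FImp sat_FAnd (sE _ x z) // (sE _ y z) //.
  by apply/implyP => /andP[xz yz]; apply/eqP; apply: h4 xz yz.
- apply/forallP => X; rewrite sat_FImp sat_FAnd !sat_FAllN.
  apply/implyP => /andP[fX /forallP H]; apply/forallP => x; apply: h5.
    by move: fX; rewrite /= vf.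
  move=> y z yX yz; have := H y; rewrite sat_FAllN => /forallP/(_ z).
  by rewrite sat_FImp sat_FAnd (@sat_FSucc _ _ _ _ y z) // yz andbT => /implyP; apply.
Qed.

End StringFormula.

Lemma sat_FString (A : finType) (g : graph unit A) vn (vs : nat -> {set gV g}) :
  sat vn vs (FString A) <-> exists w, giso g (egr w).
Proof.
split=> [/existsP[f /existsP[l H]]|[w /giso_sym/giso_iso_by[p pI]]].
  by apply: (@is_path_giso _ _ f l); apply/sat_FPath; last exact: H.
(* The formula is closed, so both valuations are first emptied; empty valuations correspond under
   any isomorphism. *)
rewrite (@sat_ext _ _ _ pred0 pred0 _ _ (@env0 _) _ (fun=> set0)) ?sc_FString //.
rewrite (sat_iso (vn := @env0 (gV (egr w))) (vs := fun=> set0) _ pI) => [|//|X v]; last first.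
  by rewrite !inE.
apply/existsP; exists ord0; apply/existsP; exists ord_max.
by apply/sat_FPath; last apply: is_path_egr.
Qed.

(** * Backward translation along an interpretation *)

(* Nodes of the interpreted graph are pairs (node, tag). [ipar] bounds the set
   variables free in the defining formulas, and [imem X c x] defines the
   membership of the node (x, c) in the value of the free set variable X. *)
Record interpretation (A B : finType) := Interpretation {
  itag : finType;
  itag0 : itag;
  ipar : nat;
  idom : itag -> nat -> formula unit A;
  iedge : B -> itag -> itag -> nat -> nat -> formula unit A;
  imem : nat -> itag -> nat -> formula unit A }.

Section Translation.
Variables (A B : finType) (I : interpretation A B).
Notation K := (itag I).
Notation q := (ipar I).

(** The defining formulas receive the names of their node variables as arguments, which avoids
    substitution; in return only these names may occur free. *)
Definition wf_interpretation :=
  [/\ forall (c : K) (x : nat), sc (pred1 x) (fun X => X < q) (idom c x),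
      forall a (c d : K) (x y : nat), sc (pred2 x y) (fun X => X < q) (iedge a c d x y)
    & forall X (c : K) (x : nat), sc (pred1 x) (fun X => X < q) (imem X c x)].

(** The shift by [q] keeps the new set variables apart from the parameters, which the defining
    formulas read. *)
Definition setvar (X : nat) (c : K) := q + pickle (X, c).

(* [tau] is the tag of each free node variable, [bnd] the set variables in whose
   scope we are; a bound set variable becomes one set variable per tag. As node
   labels live in [unit], a label test only asserts that x is assigned. *)
Fixpoint tr (tau : nat -> K) (bnd : seq nat) (f : formula unit B) :
    formula unit A :=
  match f with
  | FLab _ x => FEq _ _ x x
  | FEdge a x y => iedge a (tau x) (tau y) x y
  | FEq x y => if tau x == tau y then FEq _ _ x y else FFalse _ _
  | FIn x X => if X \in bnd then FIn _ _ x (setvar X (tau x))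
               else imem X (tau x) x
  | FNot f => FNot (tr tau bnd f)
  | FAnd f1 f2 => FAnd (tr tau bnd f1) (tr tau bnd f2)
  | FOr f1 f2 => FOr (tr tau bnd f1) (tr tau bnd f2)
  | FExN x f => FBig (fun c => FExN x (FAnd (idom c x) (tr (upd tau x c) bnd f)))
  | FExS X f => foldr (@FExS _ _) (tr tau (X :: bnd) f) [seq setvar X c | c <- enum K]
  end.

Lemma setvar_inj X Y c d : setvar X c = setvar Y d -> X = Y /\ c = d.
Proof. by move=> /addnI /(pcan_inj pickleK) []. Qed.

Lemma setvar_ge X c : (setvar X c < q) = false.
Proof. by rewrite /setvar ltnNge leq_addr. Qed.

Lemma setvar_enum X Y c :
  (setvar X c \in [seq setvar Y d | d <- enum K]) = (X == Y).
Proof.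
apply/mapP/eqP => [[d _ /setvar_inj[]]|->] //.
by exists c; rewrite ?mem_enum.
Qed.

Lemma sc_tr tau bnd f (P Q R : pred nat) : wf_interpretation ->
    sc P R f -> (forall X, X < q -> Q X) ->
    (forall X c, X \in bnd -> Q (setvar X c)) ->
  sc P Q (tr tau bnd f).
Proof.
case=> wd we wm.
elim: f tau bnd P Q R => [s x|a x y|x y|x X|f IH|f1 IH1 f2 IH2|f1 IH1 f2 IH2|x f IH|X f IH]
  tau bnd P Q R /= sf Qq Qb.
- by rewrite sf.
- case/andP: sf => Px Py; apply: sub_sc (we _ _ _ _ _) => // z.
  by case/pred2P => ->.
- by case: ifP.
- case/andP: sf => Px _; case: ifP => [Xb|_] /=; first by rewrite Px Qb.
  by apply: sub_sc (wm _ _ _) => // z /eqP->.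
- exact: IH sf _ _.
- by case/andP: sf => s1 s2; rewrite (IH1 _ _ _ _ R) // (IH2 _ _ _ _ R).
- by case/andP: sf => s1 s2; rewrite (IH1 _ _ _ _ R) // (IH2 _ _ _ _ R).
- rewrite sc_FBig; apply/forallP => c /=; rewrite (IH _ _ _ _ _ sf) // andbT.
  by rewrite (sub_sc _ _ (wd _ _)) // => y /eqP->; rewrite eqxx.
- rewrite sc_foldr_FExS; apply: IH sf _ _ => Y.
    by move=> /Qq->; rewrite implybT.
  by move=> c; rewrite inE setvar_enum => /predU1P[->|/Qb->]; rewrite ?eqxx ?implybT.
Qed.

(** All valuations agreeing with [P] on the parameters are covered, because the defining formulas
    are evaluated below the quantifiers of translated formulas. *)
Definition interprets (g : graph unit A) (P : nat -> {set gV g})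
    (g' : graph unit B) (P' : nat -> {set gV g'}) (p : gV g' -> gV g * K) :=
  [/\ injective p,
      forall vn vs x c v, (forall X, X < q -> vs X = P X) -> vn x = Some v ->
        sat vn vs (idom c x) = ((v, c) \in codom p),
      forall vn vs x y u v a, (forall X, X < q -> vs X = P X) ->
        vn x = Some (p u).1 -> vn y = Some (p v).1 ->
        sat vn vs (iedge a (p u).2 (p v).2 x y) = gedg g' u a v
    & forall vn vs x X v, (forall X, X < q -> vs X = P X) ->
        vn x = Some (p v).1 ->
        sat vn vs (imem X (p v).2 x) = (v \in P' X)].

Section Correctness.
Variables (g : graph unit A) (P : nat -> {set gV g}).
Variables (g' : graph unit B) (P' : nat -> {set gV g'}) (p : gV g' -> gV g * K).
Hypothesis pI : interprets P P' p.

(** The invariant of the induction: a node variable holds the first component of [p v] and [tau] the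
    second; for [X] in [bnd], [setvar X c] decides membership of the nodes with tag [c]; other set
    variables have their value in [P']. *)
Lemma sat_tr f (D R : pred nat) tau (bnd : seq nat) vn vs vn'
    (vs' : nat -> {set gV g'}) : sc D R f ->
    (forall x, D x -> exists v,
      [/\ vn' x = Some v, vn x = Some (p v).1 & tau x = (p v).2]) ->
    (forall X, X < q -> vs X = P X) ->
    (forall X v, X \in bnd ->
       ((p v).1 \in vs (setvar X (p v).2)) = (v \in vs' X)) ->
    (forall X, X \notin bnd -> vs' X = P' X) ->
  sat vn vs (tr tau bnd f) = sat vn' vs' f.
Proof.
case: pI => pinj pd pe pm.
elim: f D R tau bnd vn vs vn' vs' =>
  [s x|a x y|x y|x X|f IH|f1 IH1 f2 IH2|f1 IH1 f2 IH2|x f IH|X f IH]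
  D R tau bnd vn vs vn' vs' /= sf hN hq hb hf.
- by have [v [-> -> _]] := hN x sf; rewrite eqxx; case: s (glab _ _) => [] [].
- case/andP: sf => /hN[u [-> xu ->]] /hN[v [-> yv ->]].
  exact: pe.
- case/andP: sf => /hN[u [-> xu ->]] /hN[v [-> yv ->]].
  case: eqP => [E|ne].
    rewrite /= xu yv; apply/eqP/eqP => [E1|-> //]; apply: pinj.
    by rewrite [LHS]surjective_pairing E E1 -surjective_pairing.
  by rewrite sat_FFalse; apply/esym/eqP => E; rewrite E in ne.
- case/andP: sf => /hN[v [-> xv ->]] _; case: ifP => [Xb|/negbT Xb].
    by rewrite /= xv hb.
  by rewrite hf //; apply: pm.
- by congr (~~ _); apply: IH sf hN hq hb hf.
- by case/andP: sf => s1 s2; rewrite (IH1 _ _ _ _ _ _ _ _ s1 hN hq hb hf)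
    (IH2 _ _ _ _ _ _ _ _ s2 hN hq hb hf).
- by case/andP: sf => s1 s2; rewrite (IH1 _ _ _ _ _ _ _ _ s1 hN hq hb hf)
    (IH2 _ _ _ _ _ _ _ _ s2 hN hq hb hf).
- have step v : sat (upd vn x (Some (p v).1)) vs (tr (upd tau x (p v).2) bnd f) =
                sat (upd vn' x (Some v)) vs' f.
    apply: IH sf _ hq hb hf => y; rewrite /upd; case: eqP => /= [_ _|_ /hN//].
    by exists v.
  rewrite sat_FBig; apply/existsP/existsP => [[c /= /existsP[u /andP[]]]|[v H]].
    rewrite (pd _ _ _ _ u) //; last by rewrite /upd eqxx.
    case/codomP => v E; have [-> ->] : u = (p v).1 /\ c = (p v).2 by rewrite -E.
    by rewrite step; exists v.
  exists (p v).2; rewrite sat_FExN; apply/existsP; exists (p v).1.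
  rewrite sat_FAnd step H andbT (pd _ _ _ _ (p v).1) //; last by rewrite /upd eqxx.
  by rewrite -surjective_pairing codom_f.
- have bnotin Y c : Y != X -> setvar Y c \notin [seq setvar X c | c <- enum K].
    by rewrite setvar_enum.
  have qnotin Y : Y < q -> Y \notin [seq setvar X c | c <- enum K].
    by move=> Yq; apply/negP => /mapP[c _ E]; rewrite E setvar_ge in Yq.
  apply/idP/existsP => [/sat_foldr_FExS[ws [wsE H]]|[Z H]].
    (* One set per tag decodes to a set of nodes of [g']; pairs outside the range of [p] do not
       affect it. *)
    exists [set v | (p v).1 \in ws (setvar X (p v).2)].
    rewrite -(IH _ _ tau (X :: bnd) vn ws _ _ sf hN) // => Y; rewrite ?inE /upd.
    - by move=> Yq; rewrite wsE ?hq ?qnotin.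
    - move=> v; case: eqP => [->|/eqP YX] /= Yb; first by rewrite inE.
      by rewrite wsE ?hb ?bnotin.
    - by case: eqP => //= _; apply: hf.
  apply/sat_foldr_FExS.
  (* Conversely, [Z] is split by tags over the variables [setvar X c], and all other variables keep
     their values. *)
  exists (fun Y => if [pick c | Y == setvar X c] is Some c
                   then [set u | [exists v, (p v == (u, c)) && (v \in Z)]]
                   else vs Y); split=> [Y|].
    by case: pickP => // c /eqP->; rewrite setvar_enum eqxx.
  rewrite (IH _ _ _ _ _ _ _ (upd vs' X Z) sf hN) //.
  - move=> Y Yq; case: pickP => [c /eqP E|_]; last exact: hq.
    by rewrite E setvar_ge in Yq.
  - move=> Y v; rewrite inE /upd; case: (eqVneq Y X) => [->|YX] /= Yb.
      case: pickP => [c /eqP/setvar_inj[_ <-]|/(_ (p v).2)]; last by rewrite eqxx.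
      rewrite inE; apply/existsP/idP => [[u /andP[/eqP]]|vZ].
        by rewrite -surjective_pairing => /pinj->.
      by exists v; rewrite -surjective_pairing eqxx.
    case: pickP => [c /eqP/setvar_inj[E]|_]; last exact: hb.
    by rewrite E eqxx in YX.
  - by move=> Y; rewrite inE negb_or /upd => /andP[/negbTE-> /hf].
Qed.
End Correctness.

(** * Composition of an interpretation with a transduction *)

Variables (Sg2 Ga2 : finType) (T : mso_spec unit B Sg2 Ga2).
Notation CK := {: K * 'I_(ncopy T)}.

(** A copy is a pair of a tag and a copy of [T], numbered by enumeration. [FString] rejects inputs
    that are not string graphs, whose interpretation might still be accepted. For a well-formed [T]
    the domain formula has no free node variable, so [itag0] is an arbitrary choice. *)
Definition comp_spec : mso_spec unit A Sg2 Ga2 :=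
  @MsoSpec _ _ _ _ q #|CK|
    (FAnd (FString A) (tr (fun=> itag0 I) [::] (sdom T)))
    (fun k s => let c : CK := enum_val k in
       FAnd (idom c.1 0) (tr (fun=> c.1) [::] (snode T c.2 s)))
    (fun k l a => let c : CK := enum_val k in let d : CK := enum_val l in
       tr (upd (fun=> c.1) 1 d.1) [::] (sedge T c.2 d.2 a)).

Lemma wf_comp_spec : wf_interpretation -> wf_spec T -> wf_spec comp_spec.
Proof.
move=> wI [wd [wn we]]; have sT n k f tau : scoped n k f ->
    sc (fun x => x < n) (fun X => X < q) (tr tau [::] f).
  by rewrite scopedE => sf; apply: (sc_tr _ wI sf).
split; first by rewrite scopedE; apply/andP; split; [apply: sc_FString|apply: sT wd].
split=> [k s|k l a]; rewrite scopedE; last exact: sT (we _ _ _).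
apply/andP; split; last exact: sT (wn _ _).
by case: wI => wId _ _; apply: sub_sc (wId _ _) => // x /eqP->.
Qed.

Lemma spec_at_comp (g : graph unit A) P (g' : graph unit B) P' p h :
    interprets (g := g) P (g' := g') P' p -> wf_spec T ->
  spec_at comp_spec P h <-> (exists w, giso g (egr w)) /\ spec_at T P' h.
Proof.
move=> pI [wd [wn we]]; have [pinj pd _ _] := pI.
have dE : sat (@env0 _) P (tr (fun=> itag0 I) [::] (sdom T)) =
          sat (@env0 _) P' (sdom T).
  by apply: (sat_tr pI) => //; rewrite scopedE in wd; [exact: wd|].
have nE v j s : sat (env1 (p v).1) P (tr (fun=> (p v).2) [::] (snode T j s)) =
          sat (env1 v) P' (snode T j s).
  apply: (sat_tr pI) => //; first by have := wn j s; rewrite scopedE; apply.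
  by case=> // _; exists v.
have eE u v j k a :
    sat (env2 (p u).1 (p v).1) P
      (tr (upd (fun=> (p u).2) 1 (p v).2) [::] (sedge T j k a)) =
    sat (env2 u v) P' (sedge T j k a).
  apply: (sat_tr pI) => //; first by have := we j k a; rewrite scopedE; apply.
  by case=> [|[|]] // _; [exists u|exists v].
have oE : giso (out_graph T P') (out_graph comp_spec P).
  pose F (t : gV g' * 'I_(ncopy T)) : gV g * 'I_(ncopy comp_spec) :=
    ((p t.1).1, enum_rank (((p t.1).2, t.2) : CK)).
  apply: (out_giso (F := F)).
  - move=> [u j] [v k] [E1 /enum_rank_inj[E2 ->]]; congr (_, _); apply: pinj.
    by rewrite [LHS]surjective_pairing E1 E2 -surjective_pairing.
  - move=> [v j] s; rewrite [snode _ _ _]/= enum_rankK sat_FAnd nE.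
    by rewrite (pd _ _ _ _ (p v).1) // -surjective_pairing codom_f.
  (* Copies at pairs outside the range of [p] fail [idom] and give no output node. *)
  - move=> [u k] s; rewrite sat_FAnd (pd _ _ _ _ u) // => /andP[/codomP[v E] _].
    exists (v, (enum_val k : CK).2); rewrite /F /= -E /= -surjective_pairing.
    by rewrite enum_valK.
  - by move=> [u j] [v k] a; rewrite [sedge _ _ _ _]/= !enum_rankK eE.
rewrite /spec_at [sdom comp_spec]/= sat_FAnd dE; split.
  move=> [/andP[/sat_FString H ->] /(giso_trans oE)]; by [].
by move=> [/sat_FString-> [-> /(giso_trans (giso_sym oE))]].
Qed.
End Translation.

(** * From parameters to a relabelling *)

Section StringSpec.
Variables (A B : finType) (S : mso_spec unit A unit B) (m : seq A -> seq B -> Prop).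

Lemma string_spec_egr :
  (forall g h, spec_rel S g h <-> string_rel_graphs m g h) ->
  forall w z, m w z <-> spec_rel S (egr w) (egr z).
Proof.
move=> Sm w z; split=> [mwz|/Sm[w' [z' [mwz [/egr_inj-> /egr_inj->]]]] //].
by apply/Sm; exists w, z; do !split=> //; apply: giso_refl.
Qed.

(** Both relations are invariant under isomorphism, so once all inputs and outputs are string
    graphs, comparing them on [egr w] and [egr z] is enough. *)
Lemma string_specP :
  (forall g h, spec_rel S g h ->
     exists w z, giso g (egr w) /\ giso h (egr z)) ->
  (forall w z, m w z <-> spec_rel S (egr w) (egr z)) ->
  forall g h, spec_rel S g h <-> string_rel_graphs m g h.
Proof.
move=> Sg Sm g h; split=> [H|[w [z [/Sm H [/giso_sym gw /giso_sym hz]]]]].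
  have [w [z [gw hz]]] := Sg _ _ H; exists w, z; split=> //.
  by apply/Sm; apply: spec_rel_iso H.
exact: spec_rel_iso H.
Qed.
End StringSpec.

Section Decoding.
Variables (A : finType) (k : nat).
Notation D := (marked A * {set 'I_k})%type.

(** Set variables are arbitrary numbers; those from [k] on have no bit and so denote the empty
    set. *)
Definition has_bit (s : {set 'I_k}) (X : nat) :=
  [exists j : 'I_k, (val j == X) && (j \in s)].

Definition inner (g : graph unit D) (v : gV g) :=
  [exists u, succ u v] && [exists u, succ v u].

Definition decode (g : graph unit D) : graph unit A :=
  Graph {v : gV g | inner v} (fun=> tt)
    (fun u a v => [exists s, gedg g (val u) (inl a, s) (val v)]).

(* The node i of egr(w) is the node i+1 of egr(u); its parameter bits are stored
   on the incoming edge, number i. *)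
Definition decode_par (g : graph unit D) (X : nat) : {set gV (decode g)} :=
  [set v | [exists u, exists d : D, has_bit d.2 X && gedg g u d (val v)]].

(** One tag and no parameters: the former parameters are read off the edge labels. The quantified
    name [x.+1] differs from the free name [x]. *)
Definition decoding : interpretation D A :=
  Interpretation tt 0
    (fun _ x => FAnd (FExN x.+1 (FSucc D x.+1 x)) (FExN x.+1 (FSucc D x x.+1)))
    (fun a _ _ x y => FBig (fun s => FEdge unit ((inl a, s) : D) x y))
    (fun X _ x => FExN x.+1 (FBig (fun d : D =>
       if has_bit d.2 X then FEdge unit d x.+1 x else FFalse _ _))).

Lemma wf_decoding : wf_interpretation decoding.
Proof.
split=> [c x|a c d x y|X c x].
- by rewrite /= !sc_FSucc //= ?eqxx ?implybT.
- by rewrite /= sc_FBig; apply/forallP => s; rewrite /= !eqxx orbT.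
- rewrite /= sc_FBig; apply/forallP => d; case: ifP => // _.
  by rewrite /= !eqxx implybT.
Qed.

Lemma upd_same (T : Type) (e : nat -> T) x t : upd e x t x = t.
Proof. by rewrite /upd eqxx. Qed.

Lemma upd_succ (T : Type) (e : nat -> T) x t : upd e x.+1 t x = e x.
Proof. by rewrite /upd (ltn_eqF (ltnSn x)). Qed.

Lemma decoding_interprets (g : graph unit D) P :
  interprets (I := decoding) P (@decode_par g) (fun v => (val v, tt)).
Proof.
split.
- by move=> u v [/val_inj].
- move=> vn vs x [] v _ xv; rewrite sat_FAnd !sat_FExN.
  transitivity (inner v).
    congr andb; apply: eq_existsb => u; apply: sat_FSucc;
    by rewrite ?upd_same ?upd_succ.
  apply/idP/codomP => [iv|[u [->]]]; last exact: valP u.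
  by exists (Sub v iv).
- move=> vn vs x y u v a _ xu yv; rewrite sat_FBig.
  by apply: eq_existsb => s /=; rewrite xu yv.
- move=> vn vs x X v _ xv; rewrite sat_FExN inE; apply: eq_existsb => u.
  rewrite sat_FBig; apply: eq_existsb => d.
  case: (has_bit _ _); last by rewrite sat_FFalse.
  by rewrite /= upd_same upd_succ xv.
Qed.

Lemma decode_egr (w : seq A) (u : seq D) : map fst u = mark w ->
  exists f : gV (egr w) -> gV (decode (egr u)),
    iso_by f /\ forall i, val (val (f i)) = (val i).+1.
Proof.
move=> uw; have su : size u = (size w).+2.
  by rewrite -(size_map fst) uw /= size_cat size_map addn1.
have innerE (v : gV (egr u)) : inner v = (0 < val v < (size w).+2).
  have [h1 h2 _ _ _] := is_path_egr u; rewrite /inner h1 h2 -lt0n; congr (_ && _).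
  by rewrite -(inj_eq val_inj) /= ltn_neqAle -su -ltnS ltn_ord andbT.
have uE i : i < (size w).+1 -> i.+1 < (size u).+1.
  by rewrite su ltnS => /leqW.
have fP (i : gV (egr w)) : inner (Ordinal (uE i (ltn_ord i)) : gV (egr u)).
  by rewrite innerE /= ltnS ltn_ord.
exists (fun i => Sub _ (fP i)); split=> //; split=> //.
  have gP (v : gV (decode (egr u))) : (val (val v)).-1 < (size w).+1.
    by have := valP v; rewrite innerE; case: (val (val v)) => // j; rewrite ltnS.
  exists (fun v => Ordinal (gP v) : gV (egr w)) => [i|v]; first exact: val_inj.
  apply: val_inj; apply: val_inj => /=; rewrite prednK //.
  by have := valP v; rewrite innerE => /andP[].
move=> i a j; rewrite /= eqSS; case: eqP => [jE|_]; last by apply/existsP=> -[].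
have iw : i < size w by have := ltn_ord j; rewrite [nat_of_ord j]jE ltnS.
(* Edge 0 carries the left marker, so letter [i] of [w] sits on edge [i.+1]. *)
have : omap fst (onth u i.+1) = Some (inl (nth a w i)).
  rewrite -onth_map uw /= onthE map_cat nth_cat !size_map iw -map_comp.
  by rewrite (nth_map a).
rewrite (onthE w) (nth_map a) //.
change (omap fst (onth u i.+1) = Some (inl (nth a w i)) ->
  [exists s, onth u i.+1 == Some (inl a, s)] = (Some (nth a w i) == Some a)).
case: (onth u i.+1) => // -[b t] /= [->].
by apply/existsP/eqP => [[s /eqP[->]] //|[->]]; exists t.
Qed.

(** Edge [i] is the only edge into node [i.+1], so its label alone decides the bits. *)
Lemma decode_par_egr (u : seq D) X (v : gV (decode (egr u))) i d :
    val (val v) = i.+1 -> onth u i = Some d ->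
  (v \in decode_par (egr u) X) = has_bit d.2 X.
Proof.
move=> vE ud; rewrite inE; have iu : i < size u by rewrite -onthTE ud.
apply/existsP/idP => [[j /existsP[e /and3P[eX]]]|dX].
  by rewrite vE eqSS => /eqP <-; rewrite ud => /eqP[->].
exists (Ordinal (leqW iu : i < (size u).+1)); apply/existsP; exists d.
by rewrite dX /= vE ud !eqxx.
Qed.
End Decoding.

Section Backward.
Variables S1 S2 : finType.
Implicit Types m : seq S1 -> seq S2 -> Prop.

Lemma all2_fst (A B : eqType) (s : seq A) (u : seq (A * B)) :
  all2 (fun a d => a == d.1) s u = (map fst u == s).
Proof. by elim: s u => [|a s IH] [|d u] //=; rewrite IH eqseq_cons eq_sym. Qed.

(** The relabelling keeps each marked symbol and attaches an arbitrary set of parameter indices;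
    [m'] is what [T] does on all strings over [D], encodings or not. *)
Lemma nmso_relabel_dmso m : nmso_string m ->
  exists (D : finType) (R : marked S1 -> D -> bool) (m' : seq D -> seq S2 -> Prop),
    dmso_string m' /\ (forall w z, m w z <-> rcomp (marked_relab R) m' w z).
Proof.
case=> S [wS Sm]; pose k := npar S.
pose D : finType := (marked S1 * {set 'I_k})%type.
pose T : mso_spec unit D unit S2 := comp_spec (decoding S1 k) S.
have TE (g : graph unit D) h : spec_rel T g h <->
    (exists u, giso g (egr u)) /\ spec_at S (@decode_par _ _ g) h.
  split=> [[P /(spec_at_comp _ (decoding_interprets _) wS)] //|H].
  exists (fun=> set0).
  exact/(spec_at_comp _ (decoding_interprets _) wS).
have SE := string_spec_egr Sm.
have Te (u : seq D) h : spec_rel T (egr u) h <-> spec_at S (@decode_par _ _ (egr u)) h.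
  split=> [/TE[] //|H]; apply/TE; split=> //; by exists u; apply: giso_refl.
exists D, (fun a d => a == d.1), (fun u z => spec_rel T (egr u) (egr z)); split.
  exists T; split; first by split=> //; apply: wf_comp_spec (wf_decoding _ _) wS.
  apply: string_specP => // g h /TE[[u gu] H].
  (* The output is a string graph because [S] produces it from [decode g], and [S] relates only
     string graphs. *)
  have /Sm[w [z [_ [_ hz]]]] : spec_rel S (decode g) h by exists (@decode_par _ _ g).
  by exists u, z.
move=> w z; split=> [/SE[P H]|[u []]]; last first.
  rewrite /marked_relab /relab all2_fst => /eqP /decode_egr[f [fI _]] /Te H.
  apply/SE; apply: (spec_rel_iso (g := decode (egr u)) (h := egr z));
    last by exists (@decode_par _ _ (egr u)).
    exact: giso_sym (iso_by_giso fI).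
  exact: giso_refl.
(* Edge [i] records the parameters containing node [i] of [egr w]. At the right marker edge [inord]
   falls back to node 0; that edge ends at the last node, which is not inner, so these bits are
   never decoded. *)
have [i iw|u [su uP]] := @choose_string D (size w).+2
    (fun i d => onth (mark w) i = Some d.1 /\ d.2 = [set j : 'I_k | inord i \in P j]).
  case E: (onth (mark w) i) => [a|]; first by eexists (a, _).
  have : i < size (mark w) by rewrite /= size_cat size_map addn1.
  by rewrite -onthTE E.
have uw : map fst u = mark w.
  apply: eq_from_onth => i; rewrite onth_map.
  case: (ltnP i (size w).+2) => iw; first by have [d -> []] := uP i iw.
  by rewrite !onth_default //= ?su // size_cat size_map addn1.
exists u; split; first by rewrite /marked_relab /relab all2_fst uw.
apply/Te; have [f [fI fv]] := decode_egr uw.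
(* Decoding yields the empty set from index [k] on, so the valuation is emptied there. *)
pose P1 X := if X < k then P X else set0.
apply: (spec_at_iso (g := egr w) (P := P1) fI); last first.
  by apply: spec_at_ext wS _ H => X Xk; rewrite /P1 Xk.
move=> X v; have [d ud [_ dE]] := uP v (leqW (ltn_ord v)).
rewrite (decode_par_egr _ (fv v) ud) dE /P1; case: ltnP => Xk.
  apply/existsP/idP => [[j /andP[/eqP<-]]|vX]; first by rewrite inE inord_val.
  by exists (Ordinal Xk); rewrite inE inord_val /= eqxx.
rewrite inE; apply/existsP => -[j /andP[/eqP jX]].
by have := ltn_ord j; rewrite [nat_of_ord j]jX ltnNge Xk.
Qed.
End Backward.

(** * From a relabelling to parameters *)

Section Marking.
Variables (A D : finType) (R : marked A -> D -> bool).
Notation q := #|{: bool * D}|.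

(* [par true d] holds the targets of the edges relabelled d, except that the
   edge of the right end marker, which has no target in egr(w), uses
   [par false d] at the last node. *)
Definition par (b : bool) (d : D) : nat := enum_rank (b, d).

Lemma par_lt b d : par b d < q.
Proof. exact: ltn_ord. Qed.

(** Tag [None] keeps the nodes of the string; [Some true] and [Some false] copy its first and last
    node as outer ends of the two marker edges. An edge carries [d] when [R] allows it and the guess
    selects it. Free set variables denote the empty set, which suits a parameterless
    transduction. *)
Definition marking : interpretation A D :=
  Interpretation (None : option bool) q
    (fun c x => match c with
       | Some true => FNot (FExN x.+1 (FSucc A x.+1 x))
       | None => FEq _ _ x x
       | Some false => FNot (FExN x.+1 (FSucc A x x.+1))
       end)
    (fun d c c' x y => match c, c' with
       | Some true, None =>
           if R (lmark A) d then FAnd (FEq _ _ x y) (FIn _ _ y (par true d))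
           else FFalse _ _
       | None, None =>
           FAnd (FBig (fun a => if R (inl a) d then FEdge unit a x y
                                else FFalse _ _)) (FIn _ _ y (par true d))
       | None, Some false =>
           if R (rmark A) d then FAnd (FEq _ _ x y) (FIn _ _ y (par false d))
           else FFalse _ _
       | _, _ => FFalse _ _
       end)
    (fun _ _ _ => FFalse _ _).

Lemma wf_marking : wf_interpretation marking.
Proof.
split=> [c x|d c c' x y|//].
- by case: c => [[]|] /=; rewrite ?sc_FSucc //= ?eqxx ?implybT.
- case: c c' => [[]|] [[]|] //=; try (case: ifP => // _);
    rewrite /= ?eqxx ?orbT ?par_lt // ?andbT sc_FBig.
  by apply/forallP => a; case: ifP => // _; rewrite /= !eqxx orbT.
Qed.

Variable w : seq A.
Notation n := (size w).
Implicit Types P : nat -> {set 'I_n.+1}.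

Definition marked_lab P i d :=
  (if onth (mark w) i is Some a then R a d else false) &&
  (if i < n.+1 then inord i \in P (par true d) else ord_max \in P (par false d)).

Definition marked_pos (i : 'I_n.+3) : 'I_n.+1 * option bool :=
  if val i == 0 then (ord0, Some true)
  else if val i == n.+2 then (ord_max, Some false) else (inord (val i).-1, None).

Variant marked_pos_spec (i : 'I_n.+3) : 'I_n.+1 * option bool -> Prop :=
| MarkedFirst of val i = 0 : marked_pos_spec i (ord0, Some true)
| MarkedInner (j : 'I_n.+1) of val i = j.+1 : marked_pos_spec i (j, None)
| MarkedLast of val i = n.+2 : marked_pos_spec i (ord_max, Some false).

Lemma marked_posP i : marked_pos_spec i (marked_pos i).
Proof.
rewrite /marked_pos; case: eqP => [|/eqP i0]; first exact: MarkedFirst.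
case: eqP => [|/eqP im]; first exact: MarkedLast.
have il : (val i).-1 < n.+1.
  rewrite -ltnS prednK ?lt0n // ltn_neqAle im -ltnS; exact: ltn_ord.
by apply: MarkedInner; rewrite inordK // prednK ?lt0n.
Qed.

Lemma mark_inner i : i < n ->
  onth ([seq inl x | x <- w] ++ [:: rmark A]) i = omap inl (onth w i).
Proof. by move=> iw; rewrite -onth_map !onthE map_cat nth_cat !size_map iw. Qed.

Lemma mark_last : onth ([seq inl x | x <- w] ++ [:: rmark A]) n = Some (rmark A).
Proof. by rewrite onthE map_cat nth_cat !size_map ltnn subnn. Qed.

Lemma marking_interprets P :
  interprets (I := marking) (g := egr w) P
    (g' := lpath n.+2 (marked_lab P)) (fun=> set0) marked_pos.
Proof.
have [hf hl _ _ _] := is_path_egr w; split.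
- move=> i j; case: (marked_posP i) => [iE|k iE|iE];
  case: (marked_posP j) => [jE|l jE|jE] // E; apply: val_inj;
  by rewrite iE jE //; case: E => // ->.
- move=> vn vs x c v _ xv; apply/idP/codomP.
    case: c => [[]|] /=.
    + rewrite (@eq_existsb _ _ (fun u : gV (egr w) => succ u v)) => [|u]; last first.
        by apply: sat_FSucc; rewrite ?upd_same ?upd_succ.
      by rewrite hf negbK => /eqP->; exists ord0.
    + rewrite (@eq_existsb _ _ (fun u : gV (egr w) => succ v u)) => [|u]; last first.
        by apply: sat_FSucc; rewrite ?upd_same ?upd_succ.
      rewrite hl negbK => /eqP->; exists ord_max.
      by rewrite /marked_pos /= eqxx.
    + have vl : v.+1 < n.+3 by apply: leqW; rewrite ltnS.
      move=> _; exists (Ordinal vl); rewrite /marked_pos /= eqSS.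
      by rewrite (ltn_eqF (ltn_ord v)) inord_val.
  case=> i; case: (marked_posP i) => [iE|k iE|iE] [vE ->] /=; subst v.
  + rewrite (@eq_existsb _ _ (fun u : gV (egr w) => succ u ord0)) => [|u]; last first.
      by apply: sat_FSucc; rewrite ?upd_same ?upd_succ // xv.
    by rewrite hf negbK.
  + by rewrite xv eqxx.
  + rewrite (@eq_existsb _ _ (fun u : gV (egr w) => succ (ord_max : gV (egr w)) u)) => [|u]; last first.
      by apply: sat_FSucc; rewrite ?upd_same ?upd_succ // xv.
    by rewrite hl negbK.
(* Simplification turns [FFalse] into this existential for the pairs of tags without edges. *)
- have F0 : [exists v : gV (egr w), v != v] = false.
    by apply/existsP => -[v]; rewrite eqxx.
  move=> vn vs x y i j d vsE; rewrite [gedg _ _ _ _]/= /marked_lab.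
  case: (marked_posP i) => [iE|k iE|iE]; case: (marked_posP j) => [jE|l jE|jE] /= xk yl;
    rewrite ?F0 -?[nat_of_ord _]/(val _) iE jE /=.
  + by [].
  + case: ifP => _; rewrite ?sat_FFalse ?andbF //= xk yl vsE ?par_lt //.
    rewrite eqSS eq_sym -(inj_eq val_inj) /=; case: eqP => //= l0.
    by have -> : l = inord 0 by apply: val_inj; rewrite /= inordK // -l0.
  + by [].
  + by [].
  + rewrite yl vsE ?par_lt // !eqSS sat_FBig.
    case: eqP => [lk|lk]; last first.
      apply/negbTE; apply: contraPN (introN eqP lk) => /andP[/existsP[a]].
      by case: ifP; rewrite ?sat_FFalse //= xk yl => _ /andP[->].
    have kw : k < n by rewrite -ltnS -lk.
    rewrite ltnS kw -lk inord_val andTb; congr (_ && _).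
    case E: (onth w k) => [a|]; last by move: kw; rewrite -onthTE E.
    rewrite (mark_inner kw) [onth w k]E /=; apply/existsP/idP => [[b]|Ra].
      by case: ifP; rewrite ?sat_FFalse //= xk yl E => Rb /andP[_ /eqP[->]].
    by exists a; rewrite Ra /= xk yl E lk !eqxx.
  (* Only the last node has an edge to the extra right end; there [R] is tested on the right marker
     and [par false] is read. *)
  + rewrite !eqSS; case: (ltngtP k n) => [kn|nk|kn].
    - case: ifP => _; rewrite ?sat_FFalse //= xk yl -(inj_eq val_inj) /=.
      by rewrite (ltn_eqF kn).
    - by have := ltn_ord k; rewrite ltnS leqNgt nk.
    rewrite kn mark_last ltnn; case: ifP => _; rewrite ?sat_FFalse //= xk yl.
    by rewrite -(inj_eq val_inj) /= kn eqxx vsE ?par_lt.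
  + by [].
  + by rewrite !eqSS (ltn_eqF (leqW (ltn_ord l))).
  + by rewrite (ltn_eqF (ltnSn _)).
- by move=> *; rewrite sat_FFalse inE.
Qed.
End Marking.

Lemma all2_onthP (A B : Type) (R : A -> B -> bool) s u :
  all2 R s u <-> size s = size u /\
    forall i a d, onth s i = Some a -> onth u i = Some d -> R a d.
Proof.
elim: s u => [|a s IH] [|d u] //=.
- by split=> // _; split=> // i a d; rewrite onth_default.
- by split=> // -[].
- by split=> // -[].
split=> [/andP[Rad /IH[-> H]]|[[su] H]].
  by split=> // -[|i] b e /= => [[<-] [<-]|]; [|apply: H].
rewrite (H 0 a d) //; apply/IH; split=> // i; exact: (H i.+1).
Qed.

(** Under each valuation [T] reads the marked path with the guessed label sets. If it has an output,
    that path is a string graph, so by [giso_lpath] each edge has one label and the guess is a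
    relabelling along [R]. *)
Lemma relabel_dmso_nmso (S1 S2 : finType) (m : seq S1 -> seq S2 -> Prop) :
  (exists (D : finType) (R : marked S1 -> D -> bool) (m' : seq D -> seq S2 -> Prop),
    dmso_string m' /\ (forall w z, m w z <-> rcomp (marked_relab R) m' w z)) ->
  nmso_string m.
Proof.
case=> D [R [m' [[T [[wT T0] Tm]] mE]]].
pose S : mso_spec unit S1 unit S2 := comp_spec (marking R) T.
have Se (w : seq S1) (P : nat -> {set 'I_(size w).+1}) h :
    spec_at S (P : nat -> {set gV (egr w)}) h <->
    spec_at T (fun=> set0 : {set gV (lpath (size w).+2 (marked_lab R P))}) h.
  have sE := spec_at_comp (T := T) h (marking_interprets R P) wT.
  by split=> [/sE[] //|H]; apply/sE; split=> //; exists w; apply: giso_refl.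
have Te (g : graph unit D) h : spec_rel T g h <-> spec_at T (fun=> set0 : {set gV g}) h.
  split=> [[P H]|H]; last by exists (fun=> set0).
  by apply: spec_at_ext wT _ H => X; rewrite T0.
have sm (w : seq S1) : size (mark w) = (size w).+2.
  by rewrite /= size_cat size_map addn1.
have Sw (w : seq S1) h : spec_rel S (egr w) h -> exists z, giso h (egr z) /\ m w z.
  case=> P /Se /Te H; have /Tm[u [z [m'uz [gu hz]]]] := H.
  exists z; split=> //; apply/mE; exists u; split=> //.
  have [su Lu] := giso_lpath gu; apply/all2_onthP; split; first by rewrite sm.
  move=> i a d wa ud; have iu : i < (size w).+2 by rewrite su -onthTE ud.
  by have := Lu i d iu; rewrite ud eqxx /marked_lab wa => /andP[].
exists S; split; first exact: wf_comp_spec (wf_marking R) wT.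
apply: string_specP => [g h gSh|w z].
  have [w gw] : exists w, giso g (egr w).
    by case: gSh => P [/andP[/sat_FString]].
  have /Sw[z [hz _]] := spec_rel_iso gw (giso_refl h) gSh.
  by exists w, z.
split=> [/mE[u [/all2_onthP[su Ru] m'uz]]|/Sw[z' [/egr_inj-> //]]].
rewrite sm in su; have /Te H : spec_rel T (egr u) (egr z).
  by apply/Tm; exists u, z; do !split=> //; apply: giso_refl.
(* [par true d] collects the positions of [d] in [u] up to [size w]. The final symbol of [u] is
   recorded by [par false] at every node, although only the last node is consulted. *)
pose P X := [set i : 'I_(size w).+1 | [exists d,
  (X == par true d) && (onth u i == Some d) ||
  (X == par false d) && (onth u (size w).+1 == Some d)]].
have parE b d c e : (par b d == par c e) = ((b, d) == (c, e)).
  by rewrite -(inj_eq enum_rank_inj) -(inj_eq val_inj).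
have PE b d i : (i \in P (par b d)) =
    (onth u (if b then val i else (size w).+1) == Some d).
  rewrite inE; apply/existsP/idP => [[e]|ud].
    by rewrite !parE !xpair_eqE; case: b => /=; rewrite ?orbF => /andP[/eqP->].
  by exists d; rewrite !parE !xpair_eqE eqxx; case: b ud => /= ->; rewrite ?orbT.
have uL i d : i < size u -> marked_lab R P i d = (onth u i == Some d).
  move=> iu; rewrite /marked_lab !PE.
  (* Where [inord] would be out of range, the bound on [i] leaves only the final position of [u]. *)
  have -> : (if i < (size w).+1 then onth u (inord i : 'I_(size w).+1) == Some d
             else onth u (size w).+1 == Some d) = (onth u i == Some d).
    case: ltnP => iw; first by rewrite inordK.
    by congr (onth u _ == _); apply/eqP; rewrite eqn_leq iw -ltnS su iu.
  case: eqP => [ud|]; last by rewrite andbF.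
  case E: (onth (mark w) i) => [a|]; first by rewrite (Ru _ _ _ E ud).
  by move: iu; rewrite -su -sm -onthTE E.
exists P; apply/Se/Te; apply: spec_rel_iso (giso_refl _) _; last exact/Te/H.
by rewrite su; apply/giso_sym/lpath_egr.
Qed.

Theorem theorem5p6 (S1 S2 : finType) (m : seq S1 -> seq S2 -> Prop) :
  nmso_string m <->
  exists (D : finType) (R : marked S1 -> D -> bool) (m' : seq D -> seq S2 -> Prop),
    dmso_string m' /\ (forall w z, m w z <-> rcomp (marked_relab R) m' w z).
Proof. by split; [apply: nmso_relabel_dmso|apply: relabel_dmso_nmso]. Qed.
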